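(* Let $n\ge 1$, let $A\ge 0$ be fixed, and let $U(x)=0$ if $x\le A$ and $U(x)=1$ if $x>A$. Let $X_1,\dots,X_n$ be independent random variables, where $X_j$ has the Poisson distribution with unknown parameter $\lambda_j>0$, $j=1,\dots,n$. Let $S(\boldsymbol X,\boldsymbol\lambda)=\sum_{j=1}^n U(X_j)\lambda_j$, and let $V(\boldsymbol X)=\sum_{j=1}^n V(X_j)$, where $V(X_j)$ is the unbiased estimator of $U(X_j)\lambda_j$, i.e. $V(0)=0$ and $V(x)=x\,U(x-1)$ for $x=1,2,\dots$. Then $V(\boldsymbol X)$ is an admissible estimator of $S(\boldsymbol X,\boldsymbol\lambda)$ for squared error loss.
   Context: Write $\boldsymbol X=(X_1,\dots,X_n)'$ and $\boldsymbol\lambda=(\lambda_1,\dots,\lambda_n)'$, with parameter space $(0,\infty)^n$. The estimand $S(\boldsymbol X,\boldsymbol\lambda)$ depends on both the observations and the unknown parameters. Unbiasedness of $V(X_j)$ for the random quantity $U(X_j)\lambda_j$ means $E_{\lambda_j}V(X_j)=E_{\lambda_j}[U(X_j)\lambda_j]$ for all $\lambda_j>0$. Under squared error loss the risk of an estimator $\delta(\boldsymbol X)$ (a real-valued function on $\{0,1,2,\dots\}^n$) at $\boldsymbol\lambda$ is $R(\boldsymbol\lambda,\delta)=E_{\boldsymbol\lambda}\big[(\delta(\boldsymbol X)-S(\boldsymbol X,\boldsymbol\lambda))^2\big]$. An estimator $\delta$ is admissible if there is no estimator $\delta^*$ with $R(\boldsymbol\lambda,\delta^* )\le R(\boldsymbol\lambda,\delta)$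 for all $\boldsymbol\lambda\in(0,\infty)^n$ and strict inequality for at least one $\boldsymbol\lambda$. *)

(* Defs.v *)
From HB Require Import structures.
From mathcomp Require Import all_boot all_order all_algebra.
From mathcomp Require Import all_classical all_reals all_analysis.

Set Implicit Arguments.
Unset Strict Implicit.
Unset Printing Implicit Defensive.

Import Order.TTheory GRing.Theory Num.Theory.
Import numFieldNormedType.Exports.

Local Open Scope classical_set_scope.
Local Open Scope ring_scope.

Section random_variables.
Context {d : measure_display} {T : measurableType d} {R : realType}.
Local Open Scope ereal_scope.

(* Mutual independence: the product rule over every subfamily. *)
Definition independent_RVs {d' : measure_display} {T' : measurableType d'}
    {I : finType} (P : probability T R) (X : I -> {mfun T >-> T'}) : Prop :=
  forall (J : {set I}) (B : I -> set T'), (forall j, measurable (B j)) ->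
    P (\bigcap_(j in [set` J]) (X j @^-1` B j)) =
    \big[*%E/1]_(j in J) P (X j @^-1` B j).

Definition has_poisson_law (P : probability T R) (X : {mfun T >-> nat})
    (rate : R) : Prop :=
  forall k : nat, P [set w | X w = k] = (poisson_pmf rate k)%:E.

End random_variables.

Definition positive_params {R : realType} {n : nat} (lam : 'I_n -> R) : Prop :=
  forall j, 0 < lam j.

(* A statistical model: one sample space carrying the observations [X], and one
   probability per parameter; [P] is unconstrained off the parameter space. *)
Definition poisson_model {d : measure_display} {T : measurableType d}
    {R : realType} {n : nat} (P : ('I_n -> R) -> probability T R)
    (X : 'I_n -> {mfun T >-> nat}) : Prop :=
  forall lam, positive_params lam ->
    independent_RVs (P lam) X /\
    (forall j, has_poisson_law (P lam) (X j) (lam j)).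

Section estimation.
Context {d : measure_display} {T : measurableType d} {R : realType} {n : nat}.
Variables (P : ('I_n -> R) -> probability T R) (X : 'I_n -> {mfun T >-> nat}).

Definition observation (w : T) : {ffun 'I_n -> nat} := [ffun j => X j w].

(* The risk takes values in [\bar R]: an arbitrary estimator may have infinite
   risk. *)
Definition risk (S : {ffun 'I_n -> nat} -> ('I_n -> R) -> R)
    (lam : 'I_n -> R) (delta : {ffun 'I_n -> nat} -> R) : \bar R :=
  'E_(P lam)[fun w => ((delta (observation w) - S (observation w) lam) ^+ 2)%R]%E.

Definition admissible (S : {ffun 'I_n -> nat} -> ('I_n -> R) -> R)
    (delta : {ffun 'I_n -> nat} -> R) : Prop :=
  ~ exists delta' : {ffun 'I_n -> nat} -> R,
      (forall lam, positive_params lam ->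
         (risk S lam delta' <= risk S lam delta)%E) /\
      (exists lam, positive_params lam /\
         (risk S lam delta' < risk S lam delta)%E).

Definition unbiased_for (u v : nat -> R) (j : 'I_n) : Prop :=
  forall lam, positive_params lam ->
    ('E_(P lam)[fun w => v (X j w)] =
     'E_(P lam)[fun w => (u (X j w) * lam j)%R])%E.

End estimation.

Definition U {R : realType} (A : R) (x : nat) : R :=
  if x%:R <= A then 0 else 1.

Definition V {R : realType} (A : R) (x : nat) : R :=
  if x is y.+1 then x%:R * U A y else 0.

Definition S_sum {R : realType} {n : nat} (A : R) (x : {ffun 'I_n -> nat})
    (lam : 'I_n -> R) : R :=
  \sum_(j < n) U A (x j) * lam j.

Definition V_sum {R : realType} {n : nat} (A : R) (x : {ffun 'I_n -> nat}) : R :=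
  \sum_(j < n) V A (x j).

(* Main.v *)
Require Import Defs.
From HB Require Import structures.
From mathcomp Require Import all_boot all_order all_algebra.
From mathcomp Require Import all_classical all_reals all_analysis.
From mathcomp Require Import measurable_realfun lebesgue_integral_under.
From mathcomp Require Import lra ring zify.

Import Order.TTheory GRing.Theory Num.Theory.
Import numFieldNormedType.Exports.

Local Open Scope classical_set_scope.
Local Open Scope ring_scope.

(** Unbiasedness is the Poisson identity k pmf(k) = lambda pmf(k - 1), summed.

Admissibility. Let an estimator do at least as well as V for every parameter,
and let g be its difference from V. Subtracting the two risks gives, for all
lambda,

    E_lambda [g^2 + 2 g (V - S_lambda)] <= 0,

and g = 0 has to be deduced. Up to the factor exp(sum_j (1 - lambda_j)), the left
side is the integral of (g^2 + 2 g (V - S_lambda)) lambda^X under the single law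
lambda = (1, ..., 1) ([expectation_change]). It is therefore a power series in
lambda, and letting some of the lambda_j tend to 0 isolates its lowest order
coefficients.

Write b for the least integer above A, so that U(x) = 1 when x >= b and V(x) = x
when x > b, V(x) = 0 when x <= b. If g does not vanish identically, choose x0
with g(x0) != 0 that minimises sum_j min(x_j, b + 1/2), let J be the set of the
j with x0_j > b, and put lambda_j = s on J and lambda_j = t off J. Minimality
([potential_le]) says that g vanishes wherever the degree in t is smaller than
at x0, and that a point of equal degree where g does not vanish has exactly its
J-coordinates above b. On this slice V is M = sum_(j in J) X_j, and S_lambda is
#|J| s up to a term of order t. So t -> 0 leaves, with gamma the restriction of
g to the slice ([slice_inequality]),

    E [s^M (gamma^2 + 2 gamma (M - #|J| s))] <= 0   for all s > 0.

What remains is the classical argument for a one-dimensional Poisson mean. With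
F(s) = E [s^M gamma] and H(s) = exp(- #|J| s) F(s), the terms in 2 gamma are
2 s exp(#|J| s) H'(s), while Cauchy-Schwarz bounds the term in gamma^2 below by
a multiple of exp(#|J| s) H^2. Hence H^2 + c s H' <= 0 on the whole half-line,
which forces H = 0 because a nonzero solution blows up in finite log-time in one
direction ([riccati_eq0]). Then the inequality reduces to
E [s^M gamma^2] <= 0 ([ray_rigidity]), so g(x0) = 0, a contradiction. *)

Set Implicit Arguments.
Unset Strict Implicit.
Unset Printing Implicit Defensive.

(** * A Riccati inequality on the half-line *)

Lemma nonincreasing_of_derive_le0 (R : realType) (f df : R -> R) (a b : R) :
  a <= b -> (forall x, a <= x <= b -> is_derive x 1 f (df x)) ->
  (forall x, a <= x <= b -> df x <= 0) -> f b <= f a.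
Proof.
move=> ab fdf df_le0.
have cf : {within `[a, b], continuous f}.
  apply: derivable_within_continuous => x; rewrite in_itv/= => xab.
  by have [] := fdf _ xab.
have [|c] := @MVT_segment R f df a b ab _ cf.
  by move=> x xab; apply: fdf; apply: subset_itv_oo_cc xab.
rewrite in_itv/= => cab fE.
by rewrite -subr_le0 fE mulr_le0_ge0 ?df_le0// subr_ge0.
Qed.

(** Where H is nonzero, ln x / c - 1 / H is nonincreasing. As H is nonincreasing
too, a negative value stays away from 0 to the right and a positive one to the
left; then 1 / H keeps its sign and bounds ln on an unbounded range, which is
absurd. *)
Lemma riccati_eq0 (R : realType) (H dH : R -> R) (c : R) :
  0 < c -> (forall x : R, 0 < x -> is_derive x 1 H (dH x)) ->
  (forall x : R, 0 < x -> H x ^+ 2 + c * x * dH x <= 0) ->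
  forall x : R, 0 < x -> H x = 0.
Proof.
move=> c0 HdH ric.
have dH_le0 (x : R) : 0 < x -> dH x <= 0.
  move=> x0; have := ric x x0; have := sqr_ge0 (H x) => h1 h2.
  by rewrite -(pmulr_rle0 _ (mulr_gt0 c0 x0)); lra.
have Hmono (a b : R) : 0 < a -> a <= b -> H b <= H a.
  move=> a0 ab; apply: (@nonincreasing_of_derive_le0 R H dH a b ab) => x /andP[ax _].
  - exact: HdH (lt_le_trans a0 ax).
  - exact: dH_le0 (lt_le_trans a0 ax).
(* the derivative of this difference is (H^2 + c x H') / (c x H^2) *)
have key (a b : R) : 0 < a -> a <= b -> (forall x : R, a <= x <= b -> H x != 0) ->
    c^-1 * ln b - (H b)^-1 <= c^-1 * ln a - (H a)^-1.
  move=> a0 ab Hn0.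
  apply: (@nonincreasing_of_derive_le0 R (fun x => c^-1 * ln x - (H x)^-1)
    (fun x => c^-1 * x^-1 + dH x / H x ^+ 2) a b ab) => x xab.
  - have x0 : 0 < x by case/andP: xab => ax _; exact: lt_le_trans a0 ax.
    have dl := is_derive1_ln x0.
    have dHx := HdH x x0.
    have dV := is_deriveV (Hn0 x xab) dHx.
    have dZ : is_derive x 1 (fun x : R => c^-1 * ln x) (c^-1 * x^-1) := is_deriveZ c^-1 dl.
    apply: is_derive_eq.
    rewrite /= /GRing.scale/=; ring.
  - have x0 : 0 < x by case/andP: xab => ax _; exact: lt_le_trans a0 ax.
    have H0 := Hn0 x xab.
    have -> : c^-1 * x^-1 + dH x / H x ^+ 2 =
      (H x ^+ 2 + c * x * dH x) / (c * x * H x ^+ 2).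
      by field; rewrite H0 !gt_eqF.
    apply: mulr_le0_ge0; first exact: ric.
    by rewrite invr_ge0 mulr_ge0 ?sqr_ge0// (ltW (mulr_gt0 c0 x0)).
move=> x x0; apply/eqP; rewrite eq_le !leNgt; apply/andP; split; apply/negP => Hx.
(* [s] is the log-time in which 1 / H would have to drop to 0, going left *)
- pose s := c / H x; pose y := x * expR (- s).
  have s0 : 0 < s by rewrite divr_gt0.
  have y0 : 0 < y by rewrite mulr_gt0 ?expR_gt0.
  have yx : y <= x.
    by rewrite ger_pMr// -expR0 ler_expR oppr_le0 ltW.
  have Hpos z : y <= z <= x -> 0 < H z.
    by move=> /andP[yz zx]; rewrite (lt_le_trans Hx)// Hmono// (lt_le_trans y0).
  have := key y x y0 yx (fun z h => lt0r_neq0 (Hpos z h)).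
  rewrite /y lnM ?posrE ?expR_gt0// expRK -/y mulrDr mulrN /s mulrA mulVf ?gt_eqF// mul1r.
  have : 0 < (H y)^-1 by rewrite invr_gt0 Hpos// lexx yx.
  lra.
(* the same log-time, going right *)
- pose s := - c / H x; pose y := x * expR s.
  have s0 : 0 < s by rewrite /s mulNr -mulrN -invrN divr_gt0// oppr_gt0.
  have xy : x <= y.
    by rewrite ler_pMr// -expR0 ler_expR ltW.
  have Hneg z : x <= z <= y -> H z < 0.
    by move=> /andP[xz zy]; rewrite (le_lt_trans _ Hx)// Hmono.
  have := key x y x0 xy (fun z h => ltr0_neq0 (Hneg z h)).
  rewrite /y lnM ?posrE ?expR_gt0// expRK -/y mulrDr /s mulNr mulrN mulrA mulVf ?gt_eqF// mul1r.
  have : (H y)^-1 < 0 by rewrite invr_lt0 Hneg// lexx xy.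
  lra.
Qed.

(** * Power series along a ray *)

Lemma sqrn_le_exp4 (R : realDomainType) (m : nat) : (m%:R : R) ^+ 2 <= 4 ^+ m.
Proof.
by rewrite -!natrX ler_nat (_ : 4 = 2 ^ 2)%N// -expnM mulnC expnM leq_sqr ltnW// ltn_expl.
Qed.

Section integrals.
Context {d : measure_display} {T : measurableType d} {R : realType}.
Variable mu : {measure set T -> \bar R}.

Definition rintegrable (f : T -> R) : Prop := mu.-integrable setT (EFin \o f).

Lemma rintegrable_le (f g : T -> R) : measurable_fun setT f ->
  (forall w, `|f w| <= g w) -> rintegrable g -> rintegrable f.
Proof.
move=> mf fg ig; apply: (le_integrable _ _ _ ig) => //.
  exact/measurable_EFinP.
by move=> w _ /=; rewrite lee_fin (le_trans (fg w))// ler_norm.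
Qed.

Lemma rintegrableD (f g : T -> R) : rintegrable f -> rintegrable g ->
  rintegrable (fun w => f w + g w).
Proof. by move=> fi gi; exact: (integrableD measurableT fi gi). Qed.

Lemma rintegrableB (f g : T -> R) : rintegrable f -> rintegrable g ->
  rintegrable (fun w => f w - g w).
Proof. by move=> fi gi; exact: (integrableB measurableT fi gi). Qed.

Lemma rintegrableZ (c : R) (f : T -> R) : rintegrable f ->
  rintegrable (fun w => c * f w).
Proof. by move=> fi; exact: (integrableZl measurableT c fi). Qed.

Lemma rintegrable_measurable (f : T -> R) : rintegrable f -> measurable_fun setT f.
Proof. by move=> /integrableP[/measurable_EFinP]. Qed.

End integrals.

Section ray.
Context {d : measure_display} {T : measurableType d} {R : realType}.
Variables (mu : {measure set T -> \bar R}) (M : T -> nat) (phi : T -> R).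
Hypothesis mM : measurable_fun setT (fun w => (M w)%:R : R).
Hypothesis mphi : measurable_fun setT phi.
Hypothesis int_pow : forall x : R, 0 < x -> rintegrable mu (fun w => x ^+ M w).
Hypothesis int_sqr : forall x : R, 0 < x ->
  rintegrable mu (fun w => x ^+ M w * phi w ^+ 2).

Let F (x : R) : R := (\int[mu]_w (x ^+ M w * phi w))%R.

Lemma measurable_pow (x : R) : 0 < x -> measurable_fun setT (fun w => x ^+ M w).
Proof. by move=> x0; exact: rintegrable_measurable (int_pow x0). Qed.

(** The polynomial factor costs nothing because the mass is finite along the whole
ray: M^2 x^M <= (4 x)^M. *)
Lemma integrable_deg_pow (x : R) : 0 < x ->
  rintegrable mu (fun w => (M w)%:R * (x ^+ M w * phi w)).
Proof.
move=> x0.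
have x4 : 0 < 4 * x by rewrite mulr_gt0.
apply: (rintegrable_le (g := fun w => (4 * x) ^+ M w + x ^+ M w * phi w ^+ 2)).
- apply: measurable_funM => //; apply: measurable_funM => //; exact: measurable_pow.
- move=> w; rewrite exprMn.
  have xM : 0 <= x ^+ M w by rewrite exprn_ge0 // ltW.
  have M4 := sqrn_le_exp4 R (M w).
  rewrite normrM normrM [`|_%:R|]ger0_norm// [`|x ^+ _|]ger0_norm//.
  rewrite -(ler_pM2l (ltr0n R 2))//.
  have h : 0 <= ((M w)%:R - `|phi w|) ^+ 2 by exact: sqr_ge0.
  have nphi : `|phi w| ^+ 2 = phi w ^+ 2 by rewrite real_normK ?num_real.
  have e4 : 0 <= (4:R) ^+ M w by rewrite exprn_ge0.
  have p2 : 0 <= phi w ^+ 2 by exact: sqr_ge0.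
  have : x ^+ M w * (2 * ((M w)%:R * `|phi w|)) <=
         x ^+ M w * (2 * (4 ^+ M w + phi w ^+ 2)).
    apply: ler_wpM2l => //; move: h nphi M4 e4 p2.
    rewrite sqrrB => h nphi M4 e4 p2; rewrite -mulr_natl in h; lra.
  lra.
- by apply: rintegrableD; [exact: int_pow | exact: int_sqr].
Qed.

Lemma integrable_pow_fun (x : R) : 0 < x -> rintegrable mu (fun w => x ^+ M w * phi w).
Proof.
move=> x0.
apply: (rintegrable_le (g := fun w => x ^+ M w + x ^+ M w * phi w ^+ 2)).
- apply: measurable_funM => //; exact: measurable_pow.
- move=> w.
  have xM : 0 <= x ^+ M w by rewrite exprn_ge0 // ltW.
  rewrite normrM ger0_norm// -{2}[x ^+ _]mulr1 -mulrDr ler_wpM2l//.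
  have nphi : `|phi w| ^+ 2 = phi w ^+ 2 by rewrite real_normK ?num_real.
  have := sqr_ge0 (`|phi w| - 1); have := sqr_ge0 (phi w).
  rewrite sqrrB nphi; lra.
- by apply: rintegrableD; [exact: int_pow | exact: int_sqr].
Qed.

(** Differentiation under the integral sign. On the interval from 0 to 2 a the
derivative of x^M phi is dominated by its value at 2 a. The result is written
as 1 / a times an Euler derivative so that it has no truncated exponent M - 1. *)
Lemma is_derive_ray_integral (a : R) : 0 < a ->
  is_derive a 1 F (a^-1 * (\int[mu]_w ((M w)%:R * (a ^+ M w * phi w)))%R).
Proof.
move=> a0.
have b0 : 0 < 2 * a by rewrite mulr_gt0.
have Ia : [set` `]0, 2 * a[] a by rewrite /= in_itv/= a0/=; lra.
pose f (x : R) w := x ^+ M w * phi w.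
have intf (x : R) : [set` `]0, 2 * a[] x -> mu.-integrable setT (EFin \o f x).
  by rewrite /= in_itv/= => /andP[x0 _]; exact: integrable_pow_fun.
have derf (x : R) w : is_derive x 1 (f ^~ w) ((M w)%:R * x ^+ (M w).-1 * phi w).
  rewrite (_ : f ^~ w = phi w \*: (id ^+ M w)); last first.
    by apply/funext => y; rewrite /f !fctE mulrC.
  apply: is_derive_eq (is_deriveZ (phi w) (is_deriveX (M w) (is_derive_id x 1))) _.
  by rewrite /GRing.scale/= mulr1; ring.
have predM (x : R) w : 0 < x -> (M w)%:R * x ^+ (M w).-1 = x^-1 * ((M w)%:R * x ^+ M w).
  move=> x0; case: (M w) => [|m]; first by rewrite !mul0r mulr0.
  by rewrite exprS /=; field; rewrite gt_eqF.
have derfE (x : R) w : partial1of2 f x w = (M w)%:R * x ^+ (M w).-1 * phi w.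
  by rewrite partial1of2E; apply: derive_val.
pose G w := `|(2 * a)^-1 * ((M w)%:R * ((2 * a) ^+ M w * phi w))|.
have intG : mu.-integrable setT (EFin \o G).
  apply: integrable_norm; apply: rintegrableZ; exact: integrable_deg_pow.
have derf1 (x : R) w : [set` `]0, 2 * a[] x -> setT w -> derivable (f ^~ w) x 1.
  by move=> _ _; have [] := derf x w.
have G_ub (x : R) w : [set` `]0, 2 * a[] x -> setT w -> `|partial1of2 f x w| <= G w.
  rewrite /= in_itv/= => /andP[x0 xa] _.
  rewrite derfE /G [X in _ <= `|X|](_ : _ = (M w)%:R * (2 * a) ^+ (M w).-1 * phi w).
    rewrite !normrM ler_wpM2r// ler_wpM2l// ger0_norm ?exprn_ge0 ?(ltW x0)//.
    rewrite ger0_norm ?exprn_ge0 ?(ltW b0)//.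
    by rewrite lerXn2r ?nnegrE ?ltW.
  by rewrite predM// !mulrA.
have dF := derivable_under_integral measurableT Ia intf derf1
  (fun w => normr_ge0 _) intG G_ub.
have dFE := differentiation_under_integral measurableT Ia intf derf1
  (fun w => normr_ge0 _) intG G_ub.
have : is_derive a 1 F (\int[mu]_w (partial1of2 f a w))%R.
  by apply: DeriveDef => //; rewrite -derive1E dFE.
congr is_derive; rewrite -RintegralZl//; last exact: integrable_deg_pow.
by apply: eq_Rintegral => w _; rewrite derfE predM// !mulrA.
Qed.

(** Cauchy-Schwarz for the weight x^M, from the sign of the integral of
x^M (phi - s)^2 as a quadratic polynomial in s. *)
Lemma sqr_ray_integral_le (x : R) : 0 < x ->
  F x ^+ 2 <= (\int[mu]_w (x ^+ M w))%R * (\int[mu]_w (x ^+ M w * phi w ^+ 2))%R.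
Proof.
move=> x0; set m := (\int[mu]_w (x ^+ M w))%R; set B := (X in m * X).
have quad (s : R) : 0 <= B - 2 * s * F x + s ^+ 2 * m.
  have : 0 <= (\int[mu]_w (x ^+ M w * phi w ^+ 2 - 2 * s * (x ^+ M w * phi w)
      + s ^+ 2 * x ^+ M w))%R.
    apply: Rintegral_ge0 => w _.
    have -> : x ^+ M w * phi w ^+ 2 - 2 * s * (x ^+ M w * phi w)
      + s ^+ 2 * x ^+ M w = x ^+ M w * (phi w - s) ^+ 2 by ring.
    by rewrite mulr_ge0 ?sqr_ge0// exprn_ge0// ltW.
  rewrite RintegralD//; last 2 first.
  - apply: rintegrableB; first exact: int_sqr.
    by apply: rintegrableZ; exact: integrable_pow_fun.
  - by apply: rintegrableZ; exact: int_pow.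
  rewrite RintegralB//; last 2 first.
  - exact: int_sqr.
  - by apply: rintegrableZ; exact: integrable_pow_fun.
  rewrite RintegralZl//; last exact: integrable_pow_fun.
  by rewrite RintegralZl//; exact: int_pow.
have m0 : 0 <= m by apply: Rintegral_ge0 => w _; rewrite exprn_ge0// ltW.
have B0 := quad 0.
have [mpos|] := ltP 0 m.
  have := quad (F x / m); rewrite -(pmulr_lge0 _ mpos).
  have -> : (B - 2 * (F x / m) * F x + (F x / m) ^+ 2 * m) * m = m * B - F x ^+ 2.
    by field; rewrite gt_eqF.
  by rewrite subr_ge0.
rewrite le_eqVlt ltNge m0 orbF => /eqP m00.
(* with zero mass the quadratic is affine, so its slope vanishes *)
have h1 := quad ((B + 1) / F x); rewrite m00 mul0r.
have [->|F0] := eqVneq (F x) 0; first by rewrite expr0n.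
move: h1; rewrite m00 mulr0 addr0 -mulrA divfK// => h1; move: B0; lra.
Qed.

(** For H(x) = exp(- k x) F(x), the terms linear in phi integrate to
2 x exp(k x) H'(x), and Cauchy-Schwarz with the exponential total mass bounds
the quadratic term below by exp(k x) H(x)^2 / C. So H satisfies the Riccati
inequality with constant 2 C and vanishes, and the linear terms drop out of the
hypothesis. *)
Lemma ray_rigidity (k C : R) : 0 < C ->
  (forall x : R, 0 < x -> (\int[mu]_w (x ^+ M w))%R = C * expR (k * x)) ->
  (forall x : R, 0 < x ->
    (\int[mu]_w (x ^+ M w * (phi w ^+ 2 + 2 * phi w * ((M w)%:R - k * x))))%R <= 0) ->
  forall x : R, 0 < x -> (\int[mu]_w (x ^+ M w * phi w ^+ 2))%R <= 0.
Proof.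
move=> C0 massE neg.
pose D (x : R) : R := (\int[mu]_w ((M w)%:R * (x ^+ M w * phi w)))%R.
have negE (x : R) : 0 < x ->
    (\int[mu]_w (x ^+ M w * phi w ^+ 2))%R + 2 * (D x - k * x * F x) <= 0.
  move=> x0; apply: le_trans (neg x x0); rewrite le_eqVlt; apply/orP; left; apply/eqP.
  rewrite -RintegralZl//; last exact: integrable_pow_fun.
  rewrite -RintegralB//; last 2 first.
  - exact: integrable_deg_pow.
  - by apply: rintegrableZ; exact: integrable_pow_fun.
  rewrite -RintegralZl//; last first.
    by apply: rintegrableB; [exact: integrable_deg_pow
      | apply: rintegrableZ; exact: integrable_pow_fun].
  rewrite -RintegralD//.
  - by apply: eq_Rintegral => w _; ring.
  - exact: int_sqr.
  - apply: rintegrableZ; apply: rintegrableB; first exact: integrable_deg_pow.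
    by apply: rintegrableZ; exact: integrable_pow_fun.
pose H (x : R) := expR (- k * x) * F x.
pose dH (x : R) := expR (- k * x) * (x^-1 * D x - k * F x).
have HdH (x : R) : 0 < x -> is_derive x 1 H (dH x).
  move=> x0.
  have dF := is_derive_ray_integral x0.
  have dE : is_derive x 1 (fun x : R => expR (- k * x)) (- k * expR (- k * x)).
    have d1 : is_derive x 1 (fun x : R => - k * x) (- k * 1).
      exact: (is_deriveZ (- k) (is_derive_id x 1)).
    apply: is_derive_eq (is_derive1_comp (is_derive_expR (- k * x)) d1) _.
    by rewrite mulr1 mulrC.
  apply: is_derive_eq (is_deriveM dE dF) _.
  by rewrite /dH /GRing.scale /= -/(F x) -/(D x); ring.
have expK (x : R) : expR (- k * x) * expR (k * x) = 1 by rewrite -expRD mulNr addNr expR0.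
have HEx (x : R) : 0 < x -> x * dH x = expR (- k * x) * (D x - k * x * F x).
  by move=> x0; rewrite /dH; field; rewrite gt_eqF.
have ric (x : R) : 0 < x -> H x ^+ 2 + (2 * C) * x * dH x <= 0.
  move=> x0; have cs := sqr_ray_integral_le x0; rewrite massE// in cs.
  have e0 := expR_ge0 (- k * x); have e20 : 0 <= expR (- k * x) ^+ 2 by exact: sqr_ge0.
  rewrite -mulrA HEx// /H exprMn.
  apply: le_trans (lerD (ler_wpM2l e20 cs) (lexx _)) _.
  have -> : expR (- k * x) ^+ 2 * (C * expR (k * x) *
      (\int[mu]_w (x ^+ M w * phi w ^+ 2))%R) + 2 * C * (expR (- k * x) * (D x - k * x * F x))
    = (C * expR (- k * x)) * ((expR (- k * x) * expR (k * x)) *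
      (\int[mu]_w (x ^+ M w * phi w ^+ 2))%R + 2 * (D x - k * x * F x)) by ring.
  by rewrite expK mul1r mulr_ge0_le0 ?negE// mulr_ge0// ltW.
have H0 := riccati_eq0 (mulr_gt0 (ltr0n R 2) C0) HdH ric.
have F0 (x : R) : 0 < x -> F x = 0.
  by move=> x0; have /eqP := H0 x x0; rewrite mulf_eq0 gt_eqF ?expR_gt0//= => /eqP.
move=> x x0; have /le_trans := negE x x0; move: (negE x x0).
have -> : D x = 0; last by rewrite F0// mulr0 subr0 mulr0 addr0.
have : dH x = 0.
  have [_ <-] := HdH x x0.
  rewrite (@near_eq_derive _ _ _ _ (cst 0))//.
    by rewrite derive_cst.
  near=> y; apply: H0; near: y; exact: lt_nbhsr.
rewrite /dH F0// mulr0 subr0 => /eqP.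
rewrite !mulf_eq0 gt_eqF ?expR_gt0//= invr_eq0 gt_eqF//= => /eqP//.
Unshelve. all: by end_near.
Qed.

End ray.

(** * Countable observations and change of the Poisson parameter *)

Section countable_valued.
Context {d : measure_display} {T : measurableType d} {R : realType}.

Lemma measurable_countable_preimage (C : countType) (Y : T -> C)
    (mY : forall x, measurable (Y @^-1` [set x])) (B : set C) :
  measurable (Y @^-1` B).
Proof.
rewrite (_ : _ @^-1` B = \bigcup_(x in B) (Y @^-1` [set x])); last first.
  by apply/seteqP; split => [w /= Bw|w [x /= Bx ->]//]; exists (Y w).
rewrite bigcup_mkcond; apply: countable_bigcupT_measurable => // x.
by case: ifP.
Qed.

Lemma measurable_countable_comp (C : countType) (Y : T -> C)
    (mY : forall x, measurable (Y @^-1` [set x])) (phi : C -> R) :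
  measurable_fun setT (fun w => phi (Y w)).
Proof.
by move=> _ B mB; rewrite setTI; exact: (measurable_countable_preimage mY (phi @^-1` B)).
Qed.

Lemma integral_countable_nat (mu : {measure set T -> \bar R}) (Y : T -> nat)
    (mY : forall k, measurable (Y @^-1` [set k])) (f : T -> \bar R) :
  measurable_fun setT f -> (forall w, (0 <= f w)%E) ->
  (\int[mu]_w f w = \sum_(k <oo) \int[mu]_(w in Y @^-1` [set k]) f w)%E.
Proof.
move=> mf f0.
have YT : \bigcup_k (Y @^-1` [set k]) = setT.
  by apply/seteqP; split => // w _; exists (Y w).
rewrite -[in LHS]YT ge0_integral_bigcup//; first by rewrite YT.
by apply/trivIsetP => i j _ _ ij; apply/seteqP; split => // w [/= -> /eqP]; rewrite (negPf ij).
Qed.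

(** Both integrals split over the countably many fibres of Y, and the integrands
are constant on each fibre. *)
Lemma change_of_measure_countable (P Q : {measure set T -> \bar R})
    (C : countType) (Y : T -> C) (mY : forall x, measurable (Y @^-1` [set x]))
    (rho phi : C -> R) :
  (forall x, 0 <= rho x) -> (forall x, 0 <= phi x) ->
  (forall x, P (Y @^-1` [set x]) = ((rho x)%:E * Q (Y @^-1` [set x]))%E) ->
  (\int[P]_w (phi (Y w))%:E = \int[Q]_w (phi (Y w) * rho (Y w))%:E)%E.
Proof.
move=> rho0 phi0 PQ.
have fib x : (pickle \o Y) @^-1` [set pickle x] = Y @^-1` [set x].
  apply/seteqP; split => [w /= /(pcan_inj pickleK)//|w /= ->//].
have mZ k : measurable ((pickle \o Y) @^-1` [set k]).
  exact: (measurable_countable_preimage mY (pickle @^-1` [set k])).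
rewrite (integral_countable_nat P mZ); last 2 first.
- by apply/measurable_EFinP; exact: measurable_countable_comp.
- by move=> w; rewrite lee_fin.
rewrite (integral_countable_nat Q mZ); last 2 first.
- by apply/measurable_EFinP; exact: (measurable_countable_comp mY (fun x => phi x * rho x)).
- by move=> w; rewrite lee_fin mulr_ge0.
apply: eq_eseriesr => k _.
have [[w0 wk]|/forallNP nw] := pselect (exists w, pickle (Y w) = k); last first.
  rewrite (_ : _ @^-1` _ = set0) ?integral_set0//.
  by apply/seteqP; split => // w /= /nw.
rewrite -wk fib.
under eq_integral => w /set_mem /= -> do over.
under [RHS]eq_integral => w /set_mem /= -> do over.
by rewrite !integral_cst// PQ EFinM muleA.
Qed.

End countable_valued.

Section poisson.
Context {d : measure_display} {T : measurableType d} {R : realType} {n : nat}.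
Variables (P : ('I_n -> R) -> probability T R) (X : 'I_n -> {mfun T >-> nat}).
Hypothesis hX : poisson_model P X.

Local Notation obs := (observation X).

Definition monomial (lam : 'I_n -> R) (x : {ffun 'I_n -> nat}) : R :=
  \prod_j lam j ^+ x j.

Definition norm1 (x : {ffun 'I_n -> nat}) : nat := \sum_j x j.

Lemma monomial_ge0 lam x : positive_params lam -> 0 <= monomial lam x.
Proof. by move=> l0; apply: prodr_ge0 => j _; rewrite exprn_ge0// ltW. Qed.

Lemma monomialZ (c : R) lam x :
  monomial (fun j => c * lam j) x = c ^+ norm1 x * monomial lam x.
Proof.
rewrite /monomial /norm1 expr_sum -big_split /=.
by apply: eq_bigr => j _; rewrite exprMn.
Qed.

Let one_params : positive_params (fun=> 1 : R) := fun j : 'I_n => ltr01.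
Let mu := P (fun=> 1).

Lemma measurable_observation x : measurable (obs @^-1` [set x]).
Proof.
rewrite (_ : _ @^-1` _ = \bigcap_(j in [set` [set: 'I_n]%SET]) (X j @^-1` [set x j])).
  by apply: fin_bigcap_measurable => // j _; exact: measurable_funPTI.
apply/seteqP; split => [w /= <- j _ /=|w /= h]; first by rewrite ffunE.
by apply/ffunP => j; rewrite ffunE; apply: h => /=; rewrite inE.
Qed.

Lemma prob_observation lam x : positive_params lam ->
  P lam (obs @^-1` [set x]) =
  (monomial lam x * expR (- \sum_j lam j) * \prod_j ((x j)`!%:R^-1))%:E.
Proof.
move=> l0; have [ind law] := hX l0.
rewrite (_ : _ @^-1` _ = \bigcap_(j in [set` [set: 'I_n]%SET]) (X j @^-1` [set x j])); last first.
  apply/seteqP; split => [w /= <- j _ /=|w /= h]; first by rewrite ffunE.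
  by apply/ffunP => j; rewrite ffunE; apply: h => /=; rewrite inE.
rewrite ind//.
rewrite (eq_bigr (fun j => (poisson_pmf (lam j) (x j))%:E)); last first.
  by move=> j _; exact: law.
rewrite prodEFin /monomial -sumrN expR_sum -!big_split/=; congr EFin.
under eq_bigl do rewrite finset.in_setT.
by apply: eq_bigr => j _; rewrite /poisson_pmf l0 mulrAC.
Qed.

Lemma measurable_observation_comp (phi : {ffun 'I_n -> nat} -> R) :
  measurable_fun setT (fun w => phi (obs w)).
Proof. exact: (measurable_countable_comp measurable_observation). Qed.

(** All parameters are compared under the one law lambda = 1, so that expectations
become power series in lambda and every integral below is taken with respect to
a fixed measure. *)
Lemma expectation_change lam (phi : {ffun 'I_n -> nat} -> R) :
  positive_params lam -> (forall x, 0 <= phi x) ->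
  (\int[P lam]_w (phi (obs w))%:E =
   (expR (\sum_j (1 - lam j)))%:E * \int[mu]_w (phi (obs w) * monomial lam (obs w))%:E)%E.
Proof.
move=> l0 phi0.
rewrite (change_of_measure_countable (P := P lam) (Q := mu) measurable_observation
  (rho := fun x => expR (\sum_j (1 - lam j)) * monomial lam x))//; last 2 first.
- by move=> x; rewrite mulr_ge0 ?expR_ge0 ?monomial_ge0.
- move=> x; apply: (etrans (prob_observation x l0)).
  apply: esym; apply: (etrans (congr1 (mule _) (prob_observation x one_params))).
  rewrite -EFinM; congr EFin.
  rewrite big_split/= sumrN expRD [monomial (fun=> 1) x]big1 ?mul1r; last first.
    by move=> j _; rewrite expr1n.
  set s := \sum_j 1; set p := \prod_j _.
  have e : expR s * expR (- s) = 1 by rewrite -expRD subrr expR0.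
  transitivity (monomial lam x * expR (- \sum_j lam j) * p * (expR s * expR (- s))); first by ring.
  by rewrite e mulr1.
under eq_integral do rewrite mulrCA EFinM.
rewrite ge0_integralZl ?lee_fin ?expR_ge0//.
- by apply/measurable_EFinP; exact: (measurable_observation_comp (fun x => phi x * monomial lam x)).
- by move=> w _; rewrite lee_fin mulr_ge0// monomial_ge0.
Qed.

Local Notation rint phi := (rintegrable mu (fun w => phi (obs w))).

Lemma integral_monomial lam : positive_params lam ->
  (\int[mu]_w (monomial lam (obs w))%:E = (expR (\sum_j (lam j - 1)))%:E)%E.
Proof.
move=> l0.
have h1 : (\int[P lam]_w (1 : R)%:E = 1)%E.
  by rewrite integral_cst// mul1e; exact: probability_setT.
have := @expectation_change lam (fun=> 1) l0 (fun=> ler01).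
rewrite /= h1.
under eq_integral do rewrite mul1r.
move=> /(congr1 (fun z => (expR (\sum_j (lam j - 1)))%:E * z)%E).
have e : expR (\sum_j (lam j - 1)) * expR (\sum_j (1 - lam j)) = 1.
  by rewrite -expRD -big_split big1 ?expR0// => j _; rewrite /=; ring.
by rewrite mule1 muleA -EFinM e mul1e => ->.
Qed.

Lemma rintegrable_monomial lam : positive_params lam -> rint (monomial lam).
Proof.
move=> l0; apply/integrableP; split.
  by apply/measurable_EFinP; exact: measurable_observation_comp.
under eq_integral do rewrite /= ger0_norm ?monomial_ge0//.
by rewrite integral_monomial// ltry.
Qed.

Lemma Rintegral_monomial lam : positive_params lam ->
  (\int[mu]_w (monomial lam (obs w)))%R = expR (\sum_j (lam j - 1)).
Proof. by move=> l0; rewrite /Rintegral integral_monomial. Qed.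

Lemma rintegrable_observation_le (phi psi : {ffun 'I_n -> nat} -> R) :
  (forall x, `|phi x| <= psi x) -> rint psi -> rint phi.
Proof. by move=> h; apply: rintegrable_le => //; exact: measurable_observation_comp. Qed.

(** Moments are finite because N^2 <= 4^N and the factor 4^N only multiplies
the parameter by 4. *)
Lemma rintegrable_norm1_monomial lam (L : R) : positive_params lam ->
  rint (fun x => ((norm1 x)%:R + L) ^+ 2 * monomial lam x).
Proof.
move=> l0.
have l40 : positive_params (fun j => 4 * lam j) by move=> j; rewrite mulr_gt0.
apply: (@rintegrable_observation_le
  (fun x => ((norm1 x)%:R + L) ^+ 2 * monomial lam x)
  (fun x => 2 * monomial (fun j => 4 * lam j) x + (2 * L ^+ 2) * monomial lam x)).
  move=> x; have m0 := monomial_ge0 x l0.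
  have q0 : 0 <= ((norm1 x)%:R + L) ^+ 2 * monomial lam x by rewrite mulr_ge0 ?sqr_ge0.
  rewrite /= (ger0_norm q0) monomialZ [2 * (_ * _)]mulrA -mulrDl ler_wpM2r//.
  have := sqrn_le_exp4 R (norm1 x).
  have := sqr_ge0 ((norm1 x)%:R - L); rewrite sqrrB sqrrD; lra.
by apply: rintegrableD; apply: rintegrableZ; exact: rintegrable_monomial.
Qed.

End poisson.

(** * The threshold estimator *)

Section threshold.
Context {R : realType} (A : R) (hA : 0 <= A).

Lemma U_threshold x : U A x = ((Num.truncn A).+1 <= x)%N%:R.
Proof.
rewrite /U; case: x => [|y]; first by rewrite hA.
by rewrite ltnS truncn_le_nat; case: leP.
Qed.

Lemma V_threshold x : V A x = x%:R * ((Num.truncn A).+1 < x)%N%:R.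
Proof. by case: x => [|y]; rewrite /V ?mul0r// U_threshold. Qed.

Lemma U_itv x : 0 <= U A x <= 1.
Proof. by rewrite /U; case: ifP => _; rewrite ?lexx ler01. Qed.

Lemma V_itv x : 0 <= V A x <= x%:R.
Proof.
rewrite V_threshold mulr_ge0//=.
by case: (_ < _)%N; rewrite ?mulr1// mulr0.
Qed.

Lemma sqr_V_sub_S_le n (x : {ffun 'I_n -> nat}) lam (L : R) :
  positive_params lam -> \sum_j lam j <= L ->
  (V_sum A x - S_sum A x lam) ^+ 2 <= ((norm1 x)%:R + L) ^+ 2.
Proof.
move=> l0 lL.
have V0 : 0 <= V_sum A x by apply: sumr_ge0 => j _; case/andP: (V_itv (x j)).
have VN : V_sum A x <= (norm1 x)%:R.
  by rewrite /norm1 natr_sum; apply: ler_sum => j _; case/andP: (V_itv (x j)).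
have S0 : 0 <= S_sum A x lam.
  apply: sumr_ge0 => j _; rewrite mulr_ge0 ?(ltW (l0 j))//.
  by case/andP: (U_itv (x j)).
have SL : S_sum A x lam <= L.
  apply: le_trans lL; apply: ler_sum => j _.
  by rewrite ler_piMl ?(ltW (l0 j))//; case/andP: (U_itv (x j)).
rewrite -[X in X <= _]real_normK ?num_real// lerXn2r ?nnegrE//; first lra.
by rewrite ler_norml; apply/andP; split; lra.
Qed.

End threshold.

(** * Choice of the minimal point *)

Section potential.
Local Open Scope nat_scope.
Variables (n b : nat).
Implicit Types x : {ffun 'I_n -> nat}.

(** Twice the sum of the min(x_j, b + 1/2). The half-integral cap matters: a
coordinate above b weighs strictly more than b but strictly less than b + 1, so
that it is never confused with an integral value in case of equality. *)
Definition potential x : nat := \sum_j minn (2 * x j) (2 * b).+1.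

Definition degree_off (J : {set 'I_n}) x : nat := \sum_(j in ~: J) x j.
Definition degree_on (J : {set 'I_n}) x : nat := \sum_(j in J) x j.

(** Bound potential x by the sum of 2 x_j off J and of 2 b + 1 on J, a bound that is
attained at x0; this gives the first claim. If the degrees off J agree, each
minimum must equal the corresponding bound: 2 b + 1 <= 2 x_j on J, and
2 x_j <= 2 b + 1, that is x_j <= b, off J. *)
Lemma potential_le x0 x (J := [set j | b < x0 j]%SET) :
  (potential x0 <= potential x) ->
  (degree_off J x0 <= degree_off J x) /\
  (degree_off J x = degree_off J x0 -> forall j, (b < x j) = (j \in J)).
Proof.
move=> le0.
pose ub x j := if j \in J then (2 * b).+1 else (2 * x j).
have ubE y : (\sum_j ub y j = #|J| * (2 * b).+1 + 2 * degree_off J y).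
  rewrite (bigID [in J])/=; congr addn.
    by rewrite (eq_bigr (fun=> (2 * b).+1)) ?sum_nat_const// => j; rewrite /ub => ->.
  rewrite /degree_off big_distrr/=; apply: eq_big => j; first by rewrite finset.in_setC.
  by rewrite /ub => /negPf ->.
have pot0 : potential x0 = \sum_j ub x0 j.
  apply: eq_bigr => j _; rewrite /ub inE; case: ltnP; lia.
have h : (potential x <= \sum_j ub x j ?= iff
    [forall (j | true), minn (2 * x j) (2 * b).+1 == ub x j]).
  by apply: leqif_sum => j _; apply: leqif_eq; rewrite /ub; case: ifP; lia.
split.
  have [h1 _] := h; move: le0 h1; rewrite pot0 !ubE; lia.
move=> eqe j.
have [h1 h2] := h.
have : potential x == (\sum_j ub x j).
  by rewrite eqn_leq h1/= ubE eqe -ubE -pot0.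
rewrite h2 => /forallP/(_ j)/=/eqP.
by rewrite /ub inE; case: ifP => ? ?; [apply/idP|apply/negP]; lia.
Qed.

End potential.

(** * Unbiasedness, and comparison of the risks *)

Section poisson.
Context {d : measure_display} {T : measurableType d} {R : realType} {n : nat}.
Variables (P : ('I_n -> R) -> probability T R) (X : 'I_n -> {mfun T >-> nat}).
Hypothesis hX : poisson_model P X.

Local Notation obs := (observation X).
Let mu := P (fun=> 1).
Local Notation rint phi := (rintegrable mu (fun w => phi (obs w))).

Lemma expectation_poisson lam (phi : nat -> R) j : positive_params lam ->
  (forall k, 0 <= phi k) ->
  ('E_(P lam)[fun w => phi (X j w)] =
    \sum_(k <oo) (phi k * poisson_pmf (lam j) k)%:E)%E.
Proof.
move=> l0 phi0; rewrite unlock.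
have mX k : measurable (X j @^-1` [set k]) by exact: measurable_funPTI.
rewrite (integral_countable_nat (P lam) mX); last 2 first.
- by apply/measurable_EFinP; exact: (measurable_countable_comp mX).
- by move=> w; rewrite lee_fin.
apply: eq_eseriesr => k _.
under eq_integral => w /set_mem /= -> do over.
rewrite integral_cst// EFinM; congr (_ * _)%E.
by have [_ law] := hX l0; exact: law.
Qed.

Lemma V_unbiased (A : R) (hA : 0 <= A) j : unbiased_for P X (U A) (V A) j.
Proof.
move=> lam l0; have lj := l0 j.
have U0 k : 0 <= U A k by case/andP: (U_itv A k).
have V0 k : 0 <= V A k by case/andP: (V_itv hA k).
rewrite (expectation_poisson j l0 V0).
rewrite (expectation_poisson (phi := fun k => U A k * lam j) j l0); last first.
  by move=> k; rewrite mulr_ge0 ?U0// ltW.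
have pos k : (0 <= (V A k * poisson_pmf (lam j) k)%:E)%E.
  by rewrite lee_fin mulr_ge0 ?poisson_pmf_ge0.
rewrite nneseries_recl// mul0r add0e -(nneseries_addn 1)//.
apply: eq_eseriesr => k _; congr EFin.
rewrite addn1 /V /poisson_pmf lj exprS factS natrM.
by field; rewrite pnatr_eq0 -lt0n fact_gt0/= gt_eqF// ltr0n.
Qed.

Section improvement.
Variables (A : R) (hA : 0 <= A) (delta : {ffun 'I_n -> nat} -> R).
Hypothesis improves : forall lam, positive_params lam ->
  (risk P X (S_sum A) lam delta <= risk P X (S_sum A) lam (V_sum A))%E.

Let g x := delta x - V_sum A x.

(** Pointwise, (delta - S)^2 - (V - S)^2 = g^2 + 2 g (V - S). The risk of V is
finite, hence so is that of delta, and the risks may be subtracted. *)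
Lemma risk_difference lam : positive_params lam ->
  [/\ rint (fun x => g x ^+ 2 * monomial lam x),
      rint (fun x => (g x ^+ 2 + 2 * g x * (V_sum A x - S_sum A x lam)) * monomial lam x) &
      (\int[mu]_w ((g (obs w) ^+ 2 + 2 * g (obs w) *
        (V_sum A (obs w) - S_sum A (obs w) lam)) * monomial lam (obs w)))%R <= 0].
Proof.
move=> l0.
pose eV x := (V_sum A x - S_sum A x lam) ^+ 2 * monomial lam x.
pose ed x := (delta x - S_sum A x lam) ^+ 2 * monomial lam x.
have m0 x := monomial_ge0 x l0.
have iV : rint eV.
  apply: (@rintegrable_observation_le _ _ _ _ P X eV
    (fun x => ((norm1 x)%:R + \sum_j lam j) ^+ 2 * monomial lam x)).
    move=> x; rewrite (ger0_norm (mulr_ge0 (sqr_ge0 _) (m0 x))).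
    by rewrite ler_wpM2r// sqr_V_sub_S_le.
  exact: (rintegrable_norm1_monomial hX _ l0).
have riskE del : risk P X (S_sum A) lam del =
    ((expR (\sum_j (1 - lam j)))%:E *
     \int[mu]_w ((del (obs w) - S_sum A (obs w) lam) ^+ 2 * monomial lam (obs w))%:E)%E.
  rewrite /risk unlock.
  rewrite (expectation_change hX
    (phi := fun x => (del x - S_sum A x lam) ^+ 2) l0)// => x.
  exact: sqr_ge0.
have led : (\int[mu]_w (ed (obs w))%:E <= \int[mu]_w (eV (obs w))%:E)%E.
  by have := improves l0; rewrite !riskE lee_pmul2l// ?fin_numE// lte_fin expR_gt0.
have ed0 x : 0 <= ed x := mulr_ge0 (sqr_ge0 _) (m0 x).
have eV0 x : 0 <= eV x := mulr_ge0 (sqr_ge0 _) (m0 x).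
have id : rint ed.
  apply/integrableP; split; first by apply/measurable_EFinP; exact: measurable_observation_comp.
  under eq_integral do rewrite /= ger0_norm//.
  apply: (le_lt_trans led).
  move/integrableP : iV => [_]; under eq_integral do rewrite /= ger0_norm//.
  by [].
have diffE x : (g x ^+ 2 + 2 * g x * (V_sum A x - S_sum A x lam)) * monomial lam x = ed x - eV x.
  by rewrite /ed /eV /g; ring.
split.
- apply: (@rintegrable_observation_le _ _ _ _ P X
    (fun x => g x ^+ 2 * monomial lam x) (fun x => 2 * ed x + 2 * eV x)).
    move=> x; rewrite (ger0_norm (mulr_ge0 (sqr_ge0 _) (m0 x))) /ed /eV !mulrA -mulrDl ler_wpM2r//.
    rewrite /g; have := sqr_ge0 (delta x - S_sum A x lam + (V_sum A x - S_sum A x lam)).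
    by nra.
  by apply: rintegrableD; exact: rintegrableZ.
- rewrite (_ : (fun w => _) = (fun w => ed (obs w) - eV (obs w))).
    exact: rintegrableB.
  by apply/funext => w; rewrite diffE.
- under eq_Rintegral do rewrite diffE.
  rewrite RintegralB// subr_le0 /Rintegral fine_le//; exact: integrable_fin_num.
Qed.

End improvement.
End poisson.

(** * Lowest order coefficient in the small parameters *)

Section two_scales.
Context {R : realType} {n : nat}.
Implicit Types (J : {set 'I_n}) (x : {ffun 'I_n -> nat}).

Definition two_scale J (s t : R) (j : 'I_n) : R := if j \in J then s else t.

Lemma two_scale_gt0 J s t : 0 < s -> 0 < t -> positive_params (two_scale J s t).
Proof. by move=> s0 t0 j; rewrite /two_scale; case: ifP. Qed.

Lemma monomial_two_scale J s t x :
  monomial (two_scale J s t) x = s ^+ degree_on J x * t ^+ degree_off J x.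
Proof.
rewrite /monomial (bigID [in J])/= /degree_on /degree_off !expr_sum; congr (_ * _).
  by apply: eq_bigr => j jJ; rewrite /two_scale jJ.
apply: eq_big => j; first by rewrite finset.in_setC.
by move=> /negPf jJ; rewrite /two_scale jJ.
Qed.

Lemma degree_on_le J x : (degree_on J x <= norm1 x)%N.
Proof. by rewrite /norm1 (bigID [in J])/= leq_addr. Qed.

Variables (A : R) (hA : 0 <= A).

(** At a point whose coordinates above b are those in J, each coordinate in J
contributes x_j - s, and off J only the terms in t of S survive. *)
Lemma V_sub_S_two_scale J s t x :
  (forall j, ((Num.truncn A).+1 < x j)%N = (j \in J)) ->
  V_sum A x - S_sum A x (two_scale J s t) =
  (degree_on J x)%:R - #|J|%:R * s - t * \sum_(j in ~: J) U A (x j).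
Proof.
move=> xJ.
have -> : V_sum A x = (degree_on J x)%:R.
  rewrite /V_sum (bigID [in J])/= [X in _ + X]big1 ?addr0; last first.
    by move=> j jJ; rewrite V_threshold// xJ (negPf jJ) mulr0.
  by rewrite natr_sum; apply: eq_bigr => j jJ; rewrite V_threshold// xJ jJ mulr1.
have -> : S_sum A x (two_scale J s t) = #|J|%:R * s + t * \sum_(j in ~: J) U A (x j).
  rewrite /S_sum (bigID [in J])/=; congr (_ + _).
    rewrite mulr_natl -sumr_const; apply: eq_bigr => j jJ.
    by rewrite /two_scale jJ U_threshold// ltnW ?mul1r// xJ.
  rewrite mulr_sumr; apply: eq_big => j; first by rewrite finset.in_setC.
  by move=> /negPf jJ; rewrite /two_scale jJ mulrC.
by ring.
Qed.

End two_scales.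

Section rigidity.
Context {d : measure_display} {T : measurableType d} {R : realType} {n : nat}.
Variables (P : ('I_n -> R) -> probability T R) (X : 'I_n -> {mfun T >-> nat}).
Hypothesis hX : poisson_model P X.
Variables (A : R) (hA : 0 <= A) (g : {ffun 'I_n -> nat} -> R).

Local Notation obs := (observation X).
Local Notation mu := (P (fun=> 1)).
Local Notation rint phi := (rintegrable mu (fun w => phi (obs w))).
Local Notation cross lam x :=
  ((g x ^+ 2 + 2 * g x * (V_sum A x - S_sum A x lam)) * monomial lam x).

Hypothesis int_sqr : forall lam, positive_params lam ->
  rint (fun x => g x ^+ 2 * monomial lam x).
Hypothesis int_cross : forall lam, positive_params lam -> rint (fun x => cross lam x).
Hypothesis cross_le0 : forall lam, positive_params lam ->
  (\int[mu]_w (cross lam (obs w)))%R <= 0.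

Section slice.
Variable x0 : {ffun 'I_n -> nat}.
Let b := (Num.truncn A).+1.
Hypothesis min_x0 : forall x, g x != 0 -> (potential b x0 <= potential b x)%N.

Definition bulk : {set 'I_n} := [set j | ((Num.truncn A).+1 < x0 j)%N]%SET.
Let J := bulk.
Let M w : nat := degree_on J (obs w).
Definition slice x : R := if degree_off J x == degree_off J x0 then g x else 0.

Lemma slice_sqr_le x : slice x ^+ 2 <= g x ^+ 2.
Proof. by rewrite /slice; case: ifP => // _; rewrite expr0n sqr_ge0. Qed.

(** The error committed by keeping only the terms of order t^e in the cross term,
where e is the degree of x0 off J, is at most t^(e+1) times an integrable
function that does not depend on t. Three cases: where g vanishes there is
nothing to keep; on the slice the error is 2 g t u with 0 <= u <= n, and
2 g u <= g^2 + u^2; beyond the slice the whole term is discarded, and it is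
bounded below by completing the square. *)
Lemma slice_pointwise (s t : R) x : 0 < s -> 0 < t -> t <= 1 ->
  t ^+ degree_off J x0 * (s ^+ degree_on J x * (slice x ^+ 2 +
     2 * slice x * ((degree_on J x)%:R - #|J|%:R * s))) <=
  cross (two_scale J s t) x + t ^+ (degree_off J x0).+1 *
    (s ^+ degree_on J x * (g x ^+ 2 + ((norm1 x)%:R + n%:R * (s + 1)) ^+ 2)).
Proof.
move=> s0 t0 t1; set L := n%:R * (s + 1).
have sM : 0 <= s ^+ degree_on J x by rewrite exprn_ge0// ltW.
have te : 0 <= t ^+ degree_off J x0 by rewrite exprn_ge0// ltW.
have N0 : 0 <= (norm1 x)%:R :> R by [].
have L0 : 0 <= L by rewrite mulr_ge0// addr_ge0// ltW.
have nL : n%:R <= L by rewrite ler_peMr//; lra.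
have K0 : 0 <= g x ^+ 2 + ((norm1 x)%:R + L) ^+ 2 by rewrite addr_ge0 ?sqr_ge0.
rewrite monomial_two_scale; set D := V_sum A x - _.
have rest0 : 0 <= t ^+ (degree_off J x0).+1 *
    (s ^+ degree_on J x * (g x ^+ 2 + ((norm1 x)%:R + L) ^+ 2)).
  by rewrite mulr_ge0 ?exprn_ge0 ?(ltW t0)// mulr_ge0.
have [gx0|gx0] := eqVneq (g x) 0.
  have -> : slice x = 0 by rewrite /slice gx0 if_same.
  have -> : g x ^+ 2 + 2 * g x * D = 0 by rewrite gx0; ring.
  rewrite (_ : _ ^+ 2 + _ = 0); last by ring.
  by rewrite !mulr0 mul0r add0r.
have [lee same] := potential_le (min_x0 gx0).
rewrite -/bulk -/J in lee same.
move: lee; rewrite leq_eqVlt => /orP[/eqP ee|lt_e]; rewrite /slice.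
  rewrite -ee eqxx /D V_sub_S_two_scale//; last exact: same.
  set u := \sum_(j in _) _.
  have u0 : 0 <= u by apply: sumr_ge0 => j _; case/andP: (U_itv A (x j)).
  have uL : u <= L.
    apply: le_trans nL; rewrite -[n in n%:R]card_ord -sum1_card natr_sum.
    rewrite [leRHS](bigID [in ~: J])/= -[leLHS]addr0 lerD ?sumr_ge0//.
    by apply: ler_sum => j _; case/andP: (U_itv A (x j)).
  set Dx := (degree_on J x)%:R - _.
  rewrite [t ^+ _.+1]exprS -subr_ge0.
  set p := t ^+ _; set q := s ^+ _.
  have -> : (g x ^+ 2 + 2 * g x * (Dx - t * u)) * (q * p) +
      t * p * (q * (g x ^+ 2 + ((norm1 x)%:R + L) ^+ 2)) -
      p * (q * (g x ^+ 2 + 2 * g x * Dx)) =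
      p * q * (t * ((g x - u) ^+ 2 + (((norm1 x)%:R + L) ^+ 2 - u ^+ 2))) by ring.
  rewrite !mulr_ge0 ?(ltW t0)// addr_ge0 ?sqr_ge0// subr_ge0.
  by rewrite lerXn2r ?nnegrE//; lra.
rewrite gtn_eqF// expr0n/= mulr0 mul0r addr0 !mulr0.
have D2 : D ^+ 2 <= ((norm1 x)%:R + L) ^+ 2.
  apply: sqr_V_sub_S_le => //; first exact: two_scale_gt0.
  rewrite /L mulr_natl -[n in _ *+ n]card_ord -sumr_const; apply: ler_sum => j _.
  by rewrite /two_scale; case: ifP => _; lra.
have tt : t ^+ degree_off J x <= t ^+ (degree_off J x0).+1.
  by apply: ler_wiXn2l; rewrite ?(ltW t0).
have h1 : t ^+ degree_off J x * (s ^+ degree_on J x * (g x ^+ 2 + ((norm1 x)%:R + L) ^+ 2)) <=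
  t ^+ (degree_off J x0).+1 * (s ^+ degree_on J x * (g x ^+ 2 + ((norm1 x)%:R + L) ^+ 2)).
  by rewrite ler_wpM2r// mulr_ge0.
have h2 : 0 <= t ^+ degree_off J x * (s ^+ degree_on J x *
    (g x ^+ 2 + 2 * g x * D + (g x ^+ 2 + ((norm1 x)%:R + L) ^+ 2))).
  apply: mulr_ge0; first by rewrite exprn_ge0// ltW.
  apply: mulr_ge0 => //.
  have := sqr_ge0 (g x + D); have := sqr_ge0 (g x); lra.
move: h1 h2; set p := t ^+ degree_off J x; set q := s ^+ _; set r := t ^+ _.+1. lra.
Qed.

(** Integrating [slice_pointwise] and dividing by t^e bounds the integral by a
constant times t, for every t in ]0, 1]. *)
Lemma slice_inequality (s : R) : 0 < s ->
  (\int[mu]_w (s ^+ M w * (slice (obs w) ^+ 2 +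
     2 * slice (obs w) * ((M w)%:R - #|J|%:R * s))))%R <= 0.
Proof.
move=> s0; set I := (X in X <= 0); set L := n%:R * (s + 1).
pose K x := s ^+ degree_on J x * (g x ^+ 2 + ((norm1 x)%:R + L) ^+ 2).
have p1 : positive_params (two_scale J s 1) by exact: two_scale_gt0.
have monE x : monomial (two_scale J s 1) x = s ^+ degree_on J x.
  by rewrite monomial_two_scale expr1n mulr1.
have iK : rint K.
  rewrite (_ : (fun w => _) = (fun w =>
     g (obs w) ^+ 2 * monomial (two_scale J s 1) (obs w) +
     ((norm1 (obs w))%:R + L) ^+ 2 * monomial (two_scale J s 1) (obs w))).
    apply: rintegrableD; first exact: int_sqr.
    exact: (rintegrable_norm1_monomial hX L p1).
  by apply/funext => w; rewrite monE /K; ring.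
have sM x : 0 <= s ^+ degree_on J x by rewrite exprn_ge0// ltW.
pose f x := s ^+ degree_on J x * (slice x ^+ 2 +
     2 * slice x * ((degree_on J x)%:R - #|J|%:R * s)).
have iI : rint f.
  apply: (@rintegrable_observation_le _ _ _ _ P X f (fun x => 2 * K x)); last exact: rintegrableZ.
  move=> x; rewrite /f /K mulrCA normrM ger0_norm// ler_wpM2l//.
  set D := _ - _.
  have D2 : D ^+ 2 <= ((norm1 x)%:R + L) ^+ 2.
    have := degree_on_le J x; rewrite -(ler_nat R) => h.
    have h0 : 0 <= (degree_on J x)%:R :> R by [].
    have hJ0 : 0 <= #|J|%:R * s by rewrite mulr_ge0// ltW.
    have hJ : #|J|%:R * s <= L.
      rewrite /L ler_pM ?(ltW s0)//; last lra.
      by rewrite ler_nat -[leqRHS]card_ord max_card.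
    rewrite -[X in X <= _]real_normK ?num_real// lerXn2r ?nnegrE//; first lra.
    by rewrite ler_norml /D; apply/andP; split; lra.
  have g2 := slice_sqr_le x.
  have := sqr_ge0 (slice x + D); have := sqr_ge0 (slice x - D).
  have := sqr_ge0 (slice x); have := sqr_ge0 D => h1 h2 h3 h4.
  by rewrite ler_norml; apply/andP; split; lra.
pose k := (\int[mu]_w (K (obs w)))%R.
have k0 : 0 <= k.
  by apply: Rintegral_ge0 => w _; rewrite /K mulr_ge0// addr_ge0 ?sqr_ge0.
have bound (t : R) : 0 < t -> t <= 1 -> I <= t * k.
  move=> t0 t1.
  have te : 0 < t ^+ degree_off J x0 by rewrite exprn_gt0.
  have pt : positive_params (two_scale J s t) by exact: two_scale_gt0.
  have : (\int[mu]_w (t ^+ degree_off J x0 * f (obs w)))%R <=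
     (\int[mu]_w (cross (two_scale J s t) (obs w) +
        t ^+ (degree_off J x0).+1 * K (obs w)))%R.
    apply: le_Rintegral => //.
    - exact: rintegrableZ.
    - by apply: rintegrableD; [exact: int_cross|exact: rintegrableZ].
    - by move=> w _; exact: slice_pointwise.
  rewrite RintegralZl// RintegralD//; last 2 first.
  - exact: int_cross.
  - exact: rintegrableZ.
  rewrite RintegralZl// exprSr -mulrA => h.
  rewrite -(ler_pM2l te); apply: le_trans h _.
  by have := cross_le0 pt; rewrite -/k; lra.
rewrite leNgt; apply/negP => I0.
(* a value of t in ]0, 1] for which t * k is smaller than I *)
have den : 0 < I + k + 1 by lra.
have := bound (I / (I + k + 1)); rewrite divr_gt0// => /(_ isT).
rewrite ler_pdivrMr// mul1r => /(_ _); rewrite mulrAC ler_pdivlMr//.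
have Ik := mulr_ge0 (ltW I0) k0; have II := mulr_gt0 I0 I0.
move=> h; have : I * (I + k + 1) <= I * k by apply: h; lra.
lra.
Qed.

(** [slice_inequality] is the hypothesis of [ray_rigidity] for M the degree on J
and the slice of g; the total mass at s is exp(#|J| (s - 1)). The conclusion
at s = 1 contradicts the positive mass of the atom x0 unless g(x0) = 0. *)
Lemma minimal_point_eq0 : g x0 = 0.
Proof.
have p1 (s : R) : 0 < s -> positive_params (two_scale J s 1).
  by move=> s0; exact: two_scale_gt0.
have monE (s : R) x : monomial (two_scale J s 1) x = s ^+ degree_on J x.
  by rewrite monomial_two_scale expr1n mulr1.
have mM : measurable_fun setT (fun w => (M w)%:R : R).
  exact: (measurable_observation_comp X (fun x => (degree_on J x)%:R)).
have mphi : measurable_fun setT (fun w => slice (obs w)) by exact: measurable_observation_comp.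
have int_pow (s : R) : 0 < s -> rintegrable mu (fun w => s ^+ M w).
  move=> s0; rewrite (_ : (fun w => _) = (fun w => monomial (two_scale J s 1) (obs w))).
    exact: (rintegrable_monomial hX (p1 s s0)).
  by apply/funext => w; rewrite monE.
have int_sl (s : R) : 0 < s -> rintegrable mu (fun w => s ^+ M w * slice (obs w) ^+ 2).
  move=> s0.
  apply: (@rintegrable_observation_le _ _ _ _ P X (fun x => s ^+ degree_on J x * slice x ^+ 2)
    (fun x => g x ^+ 2 * monomial (two_scale J s 1) x)); last exact: int_sqr (p1 s s0).
  move=> x; rewrite monE mulrC ger0_norm.
    by rewrite ler_wpM2r ?slice_sqr_le// exprn_ge0// ltW.
  by apply: mulr_ge0; rewrite ?sqr_ge0// exprn_ge0// ltW.
have mass (s : R) : 0 < s ->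
    (\int[mu]_w (s ^+ M w))%R = expR (- #|J|%:R) * expR (#|J|%:R * s).
  move=> s0; under eq_Rintegral do rewrite -monE.
  rewrite (Rintegral_monomial hX (p1 s s0)) -expRD; congr expR.
  rewrite (bigID [in J])/= [X in _ + X]big1 ?addr0; last first.
    by move=> j /negPf jJ; rewrite /two_scale jJ subrr.
  rewrite (eq_bigr (fun=> s - 1)); last by move=> j jJ; rewrite /two_scale jJ.
  by rewrite sumr_const -mulr_natl; ring.
have := ray_rigidity mM mphi int_pow int_sl (expR_gt0 _) mass slice_inequality (@ltr01 R).
under eq_Rintegral do rewrite expr1n mul1r.
have i2 : rint (fun x => slice x ^+ 2).
  rewrite (_ : (fun w => _) = (fun w => 1 ^+ M w * slice (obs w) ^+ 2)).
    exact: int_sl.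
  by apply/funext => w; rewrite expr1n mul1r.
apply: contraTeq => gx0; rewrite -ltNge.
have atom : (0 < mu (obs @^-1` [set x0]))%E.
  have := prob_observation hX x0 (fun j => @ltr01 R).
  move=> /= ->; rewrite lte_fin !mulr_gt0 ?expR_gt0//.
    by apply: prodr_gt0 => j _; rewrite expr1n.
  by apply: prodr_gt0 => j _; rewrite invr_gt0 ltr0n fact_gt0.
have sub := @ge0_subset_integral _ _ _ mu (obs @^-1` [set x0]) setT
  (measurable_observation X x0) measurableT (fun w => (slice (obs w) ^+ 2)%:E).
rewrite -lte_fin /Rintegral fineK; last exact: integrable_fin_num.
apply: lt_le_trans (sub _ _ _) => //.
- under eq_integral => w /set_mem /= -> do over.
  rewrite integral_cst; last exact: measurable_observation.
  rewrite mule_gt0// lte_fin /slice eqxx exprn_even_gt0//.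
- by apply/measurable_EFinP; exact: rintegrable_measurable i2.
- by move=> w _; rewrite lee_fin sqr_ge0.
Qed.

End slice.

Lemma difference_eq0 x : g x = 0.
Proof.
apply/eqP/negPn/negP => gx.
pose b := (Num.truncn A).+1.
pose Q := [pred m | `[< exists2 y, g y != 0 & potential b y = m >]].
have exQ : exists m, Q m by exists (potential b x); apply/asboolP; exists x.
have [y gy ym] : exists2 y, g y != 0 & potential b y = ex_minn exQ.
  by case: ex_minnP => m /asboolP.
move/eqP: gy; apply; apply: minimal_point_eq0 => z gz.
by rewrite ym; case: ex_minnP => m _; apply; apply/asboolP; exists z.
Qed.

End rigidity.

Theorem theorem3p1 (R : realType) (n : nat) (hn : (1 <= n)%N)
    (A : R) (hA : 0 <= A)
    (d : measure_display) (T : measurableType d)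
    (P : ('I_n -> R) -> probability T R) (X : 'I_n -> {mfun T >-> nat})
    (hX : poisson_model P X) :
  (forall j : 'I_n, unbiased_for P X (U A) (V A) j) /\
  admissible P X (S_sum A) (V_sum A).
Proof.
split; first by move=> j; exact: V_unbiased.
move=> [delta [improves [lam [l0]]]].
suff -> : delta = V_sum A by rewrite ltxx.
apply/funext => x; apply/eqP; rewrite -subr_eq0; apply/eqP.
pose g y := delta y - V_sum A y.
apply: (@difference_eq0 _ _ _ _ P X hX A hA g) => rho rho0;
  by have [] := risk_difference hX hA improves rho0.
Qed.
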